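(* Let $k\ge 0$ be an integer and let $G$ be a finite graph of treewidth $k$ and maximum degree $\Delta(G) \geq (k+3)^2/2$. Then $\mathrm{ch}'(G) = \Delta(G)$.
   Context: A tree decomposition of a graph $G$ is a pair $(T,\{V_t\}_{t\in V(T)})$ where $T$ is a tree and $V_t\subseteq V(G)$ are bags such that every vertex of $G$ lies in some bag, both endpoints of every edge lie in a common bag, and for each vertex $v$ the set of $t$ with $v\in V_t$ induces a connected subtree of $T$. Its width is the maximum bag size minus one, and the treewidth of $G$ is the minimum width of a tree decomposition of $G$. An assignment of lists is a map $L$ from $E(G)$ to subsets of $\mathbb{N}$; an $L$-edge-colouring is a map $\gamma$ on $E(G)$ with $\gamma(e)\in L(e)$ for all $e$ such that any two edges sharing an endvertex receive different colours. The list chromatic index $\mathrm{ch}'(G)$ is the smallest integer $m$ such that for every assignment of lists $L$ with $|L(e)|=m$ for all edges $e$, there is an $L$-edge-colouring of $G$. *)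

(* Defs.v *)
(* MathComp. Finite simple graphs, treewidth and the list chromatic index. *)
From mathcomp Require Import all_boot finmap boolp.

Set Implicit Arguments.
Unset Strict Implicit.
Unset Printing Implicit Defensive.

Record sgraph := SGraph {
  vertex :> finType;
  adj : rel vertex;
  adj_sym : symmetric adj;
  adj_irr : irreflexive adj
}.

Notation "x -- y" := (adj x y) (at level 30).

Section Graphs.
Variable G : sgraph.

Definition edges : {set {set G}} :=
  [set [set p.1; p.2] | p in [pred p : G * G | p.1 -- p.2]].

Definition degree (v : G) : nat := #|[set u | v -- u]|.

Definition max_degree : nat := \max_(v : G) degree v.

Definition connected_in (A : {set G}) : Prop :=
  {in A &, forall x y, connect [rel u v | [&& u \in A, v \in A & u -- v]] x y}.

Definition acyclic : Prop :=
  forall c : seq G, 2 < size c -> ~ ucycle (@adj G) c.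

Definition is_tree : Prop :=
  [/\ 0 < #|G|, connected_in [set: G] & acyclic].

End Graphs.

Section Treewidth.
Variable G : sgraph.

Record tree_decomposition (T : sgraph) (bag : T -> {set G}) : Prop := {
  td_tree : is_tree T;
  td_vertex : forall v : G, exists t, v \in bag t;
  td_edge : forall u v : G, u -- v -> exists t, (u \in bag t) && (v \in bag t);
  td_connected : forall v : G, connected_in [set t | v \in bag t]
}.

(* The predecessor truncates only when all bags are empty, which forces G to *)
(* have no vertices: that graph gets treewidth 0.                            *)
Definition width (T : sgraph) (bag : T -> {set G}) : nat :=
  (\max_(t : T) #|bag t|).-1.

Definition has_width (w : nat) : Prop :=
  exists (T : sgraph) (bag : T -> {set G}),
    tree_decomposition bag /\ width bag = w.

Lemma ex_has_width : exists w, `[< has_width w >].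
Proof.
pose T := @SGraph unit (fun _ _ => false) (fun _ _ => erefl) (fun _ => erefl).
pose bag (_ : T) := [set: G].
exists (width bag); apply/asboolP; exists T, bag; split=> //; split.
- split; first by rewrite card_unit.
    by move=> [] [] _ _; apply: connect0.
  by case=> [|x [|y c]] //= _ /andP[].
- by move=> v; exists tt; rewrite inE.
- by move=> u v _; exists tt; rewrite !inE.
- by move=> v [] [] _ _; apply: connect0.
Qed.

Definition treewidth : nat := ex_minn ex_has_width.

End Treewidth.

Section ListEdgeColouring.
Variable G : sgraph.

(* Lists and colourings are total functions on vertex sets; only their values *)
(* on the edges of G matter.                                                  *)
Definition list_edge_colouring (L : {set G} -> {fset nat})
    (gamma : {set G} -> nat) : Prop :=
  {in edges G, forall e, gamma e \in L e} /\
  {in edges G &, forall e f, e != f -> e :&: f != set0 -> gamma e != gamma f}.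

Definition edge_choosable (m : nat) : Prop :=
  forall L : {set G} -> {fset nat},
    {in edges G, forall e, #|` L e| = m} ->
    exists gamma, list_edge_colouring L gamma.

Lemma ex_edge_choosable : exists m, `[< edge_choosable m >].
Proof.
exists (size (enum (edges G))); apply/asboolP => L sizeL.
have {sizeL}: {in enum (edges G), forall e, size (enum (edges G)) <= #|` L e|}.
  by move=> e; rewrite mem_enum => /sizeL ->.
suff greedy s : {in s, forall e, size s <= #|` L e|} ->
    exists gamma, {in s, forall e, gamma e \in L e} /\
      {in s &, forall e f : {set G}, e != f -> gamma e != gamma f}.
  move=> /greedy[gamma [gammaL gammaI]]; exists gamma; split=> [e eE|e f eE fE].
    by apply: gammaL; rewrite mem_enum.
  by move=> neq _; apply: gammaI; rewrite ?mem_enum.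
elim: s => [|e s IHs] sizeL; first by exists (fun=> 0).
have [|gamma [gammaL gammaI]] := IHs.
  by move=> f fs; apply/ltnW/sizeL; rewrite inE fs orbT.
have [c cL cNs] : exists2 c, c \in L e & c \notin map gamma s.
  apply/hasP; rewrite has_predC; apply/negP => /allP sub.
  have := uniq_leq_size (fset_uniq (L e)) sub.
  by rewrite size_map leqNgt sizeL // mem_head.
exists (fun f => if f \in s then gamma f else c); split.
  move=> f; rewrite inE; case: ifP => [fs _|_]; first exact: gammaL.
  by rewrite orbF => /eqP->.
move=> f g; rewrite !inE.
case: ifP => [fs _|_]; case: ifP => [gs _|_]; rewrite ?orbF.
- exact: gammaI.
- by move=> _ _; apply: contraNneq cNs => <-; apply: map_f.
- by move=> _ _; apply: contraNneq cNs => ->; apply: map_f.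
- by move=> /eqP-> /eqP->; rewrite eqxx.
Qed.

Definition list_chromatic_index : nat := ex_minn ex_edge_choosable.

End ListEdgeColouring.

(* Main.v *)
Require Import Defs.
From mathcomp Require Import all_boot finmap boolp zify.

Set Implicit Arguments.
Unset Strict Implicit.
Unset Printing Implicit Defensive.

(** The lower bound comes from giving all edges the same list. For the upper bound, once no edge can
    be coloured greedily, small width forces many vertices of low degree whose neighbours all lie in
    one bag ([tree_decomposition_top]). [dense_subset] trims them until no edge has a larger degree
    at its outer end than at its bag end. This is the situation in which [bipartite_list_colouring]
    needs only lists as long as the degree of the bag end. There, Galvin's proper edge-colouring is
    replaced by the levels of [edge_levels], which may repeat at outer ends; [stable_matching]
    supplies kernels, and [kernel_colouring] turns them into a list colouring. [subgraph_colouring]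
    runs the induction. *)

(* Induct on the number of edges. Let D be the maximum degree. An edge uv     *)
(* with d(u) + d(v) <= D + 1 is removed and coloured greedily, so assume      *)
(* there is none. Then the vertices of degree at most D/2 are independent,    *)
(* and all neighbours of a vertex of degree d have degree at least D + 2 - d. *)
(* Let v be a vertex of degree more than D/2 whose subtree of bags has the    *)
(* deepest top, and B the bag at this top. The neighbours of v outside B have *)
(* small degree and all their neighbours lie in B, whence d(v) >= D + 1 - k   *)
(* and there are at least D + 1 - 2k > k(k+1)/2 of them. Discarding at most   *)
(* k + (k-1) + ... + 1 of them leaves a nonempty set U such that, in the      *)
(* bipartite graph H between U and B, d(u) <= d(w) for each edge uw with w in *)
(* B. Colour the remaining edges first: an edge uw of H keeps at least        *)
(* d_H(w) colours, and H can be coloured from such lists by a variant of      *)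
(* Galvin's theorem.                                                          *)

(* Rado's argument: if neither of two elements can be dropped from [r x],     *)
(* the two obstructing sets violate Hall's condition by submodularity.        *)
Lemma hall (A B : finType) (b0 : B) (X : {set A}) (r : A -> {set B}) :
  (forall Y : {set A}, Y \subset X -> #|Y| <= #|\bigcup_(y in Y) r y|) ->
  exists f : A -> B,
    {in X &, injective f} /\ {in X, forall x, f x \in r x}.
Proof.
have [n] := ubnP (\sum_x #|r x|).
elim: n r => // n IHn r; rewrite ltnS => le_n hallr.
have [/exists_inP[x xX /card_gt1P[a [b [ax bx neq_ab]]]]|] :=
  boolP [exists x in X, 1 < #|r x|]; last first.
  rewrite negb_exists_in => /forall_inP le1.
  have r1 x : x \in X -> r x = [set odflt b0 [pick b in r x]].
    move=> xX; have := hallr [set x]; rewrite sub1set big_set1 cards1 => /(_ xX).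
    have := le1 x xX; rewrite -leqNgt => ? ?.
    have /cards1P[b ->]: #|r x| == 1 by lia.
    by case: pickP => [c|/(_ b)]; rewrite inE ?eqxx // => /eqP->.
  exists (fun x => odflt b0 [pick b in r x]); split=> [x y xX yX eqf|x xX].
    apply/eqP/negPn/negP => neq_xy.
    have := hallr [set x; y]; rewrite cards2 neq_xy subUset !sub1set xX yX.
    rewrite big_setU1 ?inE //= big_set1 r1 // (r1 y) // eqf setUid cards1.
    by move/(_ isT).
  by rewrite {2}r1 ?inE.
pose r' c y := if y == x then r x :\ c else r y.
have r'sub c y : r' c y \subset r y.
  by rewrite /r'; case: eqP => // ->; apply: subD1set.
have small c : c \in r x -> \sum_y #|r' c y| < n.
  move=> cx; apply: leq_trans le_n; rewrite (bigD1 x) //= [leqRHS](bigD1 x) //=.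
  rewrite {1}/r' eqxx (cardsD1 c (r x)) cx -addSn leq_add //.
  by apply: leq_sum => y _; apply/subset_leq_card/r'sub.
have done c : c \in r x ->
    (forall Y : {set A}, Y \subset X -> #|Y| <= #|\bigcup_(y in Y) r' c y|) ->
    exists f : A -> B,
    {in X &, injective f} /\ {in X, forall x, f x \in r x}.
  move=> cx /(IHn _ (small c cx))[f [finj fr]]; exists f; split=> // y /fr.
  exact/subsetP/r'sub.
have bad c : c \in r x ->
    (exists f : A -> B, {in X &, injective f} /\ {in X, forall x, f x \in r x})
    \/ exists Y : {set A}, [/\ Y \subset X, x \in Y &
                            #|\bigcup_(y in Y) r' c y| < #|Y|].
  move=> cx.
  have [/forall_inP/(done c cx)|] :=
    boolP [forall (Y : {set A} | Y \subset X), #|Y| <= #|\bigcup_(y in Y) r' c y|].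
    by left.
  rewrite negb_forall_in => /exists_inP[Y YX]; rewrite -ltnNge => ltY; right.
  exists Y; split=> //; apply: contraLR ltY => xY; rewrite -leqNgt.
  apply: (leq_trans (hallr Y YX)); apply/subset_leq_card/bigcupsP => y yY.
  suff -> : r y = r' c y by apply: bigcup_sup.
  by rewrite /r'; case: eqP => // eqyx; rewrite -eqyx yY in xY.
have [//|[Y [YX xY ltY]]] := bad a ax.
have [//|[Z [ZX xZ ltZ]]] := bad b bx.
have := hallr (Y :|: Z); rewrite subUset YX ZX => /(_ isT) hU.
have := hallr ((Y :&: Z) :\ x).
have -> : (Y :&: Z) :\ x \subset X.
  by apply/subsetP => y; rewrite !inE => /and3P[_ /(subsetP YX)].
move=> /(_ isT) hI.
set P := \bigcup_(y in Y) r' a y in ltY; set Q := \bigcup_(y in Z) r' b y in ltZ.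
(* No value of [r x] is lost: [a] survives in [Q] because [a != b], every other value in [P]. *)
have subU : \bigcup_(y in Y :|: Z) r y \subset P :|: Q.
  apply/bigcupsP => y yYZ; apply/subsetP => c cy; rewrite inE.
  have [eqyx|neq] := eqVneq y x.
    rewrite eqyx in cy; have [eqca|neq] := eqVneq c a.
      apply/orP; right; apply/bigcupP; exists x => //.
      by rewrite /r' eqxx !inE cy eqca neq_ab.
    apply/orP; left; apply/bigcupP; exists x => //.
    by rewrite /r' eqxx !inE cy neq.
  by move: yYZ; rewrite inE => /orP[yY|yZ]; apply/orP; [left|right];
    apply/bigcupP; exists y => //; rewrite /r' (negPf neq).
have subI : \bigcup_(y in (Y :&: Z) :\ x) r y \subset P :&: Q.
  apply/bigcupsP => y; rewrite !inE => /and3P[neq yY yZ].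
  apply/subsetP => c cy; rewrite inE; apply/andP; split; apply/bigcupP;
    by exists y => //; rewrite /r' (negPf neq).
(* Hall's condition for [Y :|: Z] and [(Y :&: Z) :\ x] gives [#|P| + #|Q| >= #|Y| + #|Z| - 1], but
   both obstructions together give at most [#|Y| + #|Z| - 2]. *)
have := subset_leq_card subU; have := subset_leq_card subI.
have := cardsUI P Q; have := cardsUI Y Z.
have := cardsD1 x (Y :&: Z); rewrite inE xY xZ.
clear -ltY ltZ hU hI; lia.
Qed.

(** * Stable matchings and kernels *)

(* If two edges best at their [t]-end share their [s]-end, the worse of them  *)
(* may be discarded: the better one, or whatever beats it, beats it as well.  *)
Lemma stable_matching (E A B : finType) (s : E -> A) (t : E -> B)
    (ks kt : E -> nat) (H : {set E}) :
  {in H &, forall e f, s e = s f -> ks e = ks f -> e = f} ->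
  {in H &, forall e f, t e = t f -> kt e = kt f -> e = f} ->
  exists S : {set E}, [/\ S \subset H,
    {in S &, forall e f, e != f -> s e != s f /\ t e != t f} &
    {in H :\: S, forall e, exists2 f, f \in S &
       (s e == s f) && (ks f < ks e) || (t e == t f) && (kt f < kt e)}].
Proof.
have [n] := ubnP #|H|; elim: n H => // n IHn H.
rewrite ltnS => le_n injs injt.
pose best := [set e in H | [forall f in H, (t e == t f) ==> (kt e <= kt f)]].
have bestH e : e \in best -> e \in H by rewrite inE => /andP[].
have bestP e f : e \in best -> f \in H -> t e = t f -> kt e <= kt f.
  rewrite inE => /andP[_ /forall_inP le_e] fH eqt.
  by have := le_e f fH; rewrite eqt eqxx.
have [|] := boolP [exists e in best, [exists f in best,
    (s e == s f) && (ks f < ks e)]].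
  case/exists_inP => e eb /exists_inP[f fb /andP[/eqP eqs ltk]].
  have eH := bestH e eb; have fH := bestH f fb.
  have [|||S [SH Smat Sstab]] := IHn (H :\ e).
  - by have := cardsD1 e H; rewrite eH; lia.
  - by move=> g h; rewrite !inE => /andP[_ gH] /andP[_ hH]; apply: injs.
  - by move=> g h; rewrite !inE => /andP[_ gH] /andP[_ hH]; apply: injt.
  exists S; split=> //; first exact: (subset_trans SH (subD1set _ _)).
  move=> g; rewrite inE => /andP[gS gH].
  have [eqge|neq] := eqVneq g e; last by apply: Sstab; rewrite !inE gS neq.
  have [fS|fS] := boolP (f \in S).
    by exists f => //; rewrite eqge eqs eqxx ltk.
  have [|h hS] := Sstab f.
    by rewrite !inE fS fH andbT; apply: contraTneq ltk => ->; rewrite ltnn.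
  have hH : h \in H by have := subsetP SH h hS; rewrite inE => /andP[].
  case/orP => /andP[/eqP eqh lth].
    by exists h => //; rewrite eqge eqs eqh eqxx (ltn_trans lth ltk).
  by have := bestP f h fb hH eqh; rewrite leqNgt lth.
rewrite negb_exists_in => /forall_inP nob.
have {}nob e f : e \in best -> f \in best -> s e = s f -> ks f < ks e -> False.
  move=> eb fb eqs lt; have := nob e eb; rewrite negb_exists_in => /forall_inP.
  by move/(_ f fb); rewrite eqs eqxx lt.
(* Without competition at the [s]-ends, the favourite edges of the [t]-vertices already form a
   stable matching. *)
exists best; split.
- by apply/subsetP.
- move=> e f eb fb neq; have eH := bestH e eb; have fH := bestH f fb.
  split; apply: contraNneq neq => eqst; apply/eqP.
    apply: (injs e f eH fH eqst); apply/eqP; rewrite eqn_leq.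
    apply/andP; split; rewrite leqNgt; apply/negP; first
      exact: nob eb fb eqst.
    exact: nob fb eb (esym eqst).
  apply: (injt e f eH fH eqst); apply/eqP; rewrite eqn_leq.
  by rewrite (bestP e f) // (bestP f e).
move=> e; rewrite inE => /andP[eb eH].
have eP : (e \in H) && (t e == t e) by rewrite eH eqxx.
case: (arg_minnP (P := [pred f | (f \in H) && (t e == t f)]) kt eP)
  => f /= /andP[fH /eqP eqt] fmin.
have fb : f \in best.
  rewrite inE fH; apply/forall_inP => g gH; apply/implyP => /eqP eqg.
  by apply: fmin; rewrite gH eqt eqg eqxx.
exists f => //; rewrite eqt eqxx /= orbC ltnNge; apply/orP; left.
apply: contra eb => le_fe.
suff -> : e = f by [].
by apply: (injt e f eH fH eqt); apply/eqP; rewrite eqn_leq le_fe fmin // eH eqxx.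
Qed.

Lemma size_filter_notin (C : eqType) (l s : seq C) :
  uniq l -> size l <= size [seq c <- l | c \notin s] + size s.
Proof.
move=> ul; rewrite size_filter -(count_predC (mem s) l) addnC leq_add2l.
rewrite -size_filter uniq_leq_size ?filter_uniq // => c.
by rewrite mem_filter => /andP[].
Qed.

(* Bondy, Boppana and Siegel: colour a kernel of the edges whose list         *)
(* contains [c] with [c]; every other such edge loses a dominating edge along *)
(* with the colour [c].                                                       *)
Lemma kernel_colouring (E : finType) (dom : rel E) (H : {set E})
    (L : E -> seq nat) :
  (forall K : {set E}, K \subset H -> exists S : {set E},
     [/\ S \subset K, {in S &, forall e f, ~~ dom e f} &
         {in K :\: S, forall e, exists2 f, f \in S & dom e f}]) ->
  {in H, forall e, uniq (L e)} ->
  {in H, forall e, #|[set f in H | dom e f]| < size (L e)} ->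
  exists gamma : E -> nat, {in H, forall e, gamma e \in L e} /\
    {in H &, forall e f, dom e f -> gamma e != gamma f}.
Proof.
have [n] := ubnP #|H|; elim: n H L => // n IHn H L.
rewrite ltnS => le_n kern Luniq Lsize.
have [->|[e0 e0H]] := set_0Vmem H.
  by exists (fun=> 0); split=> e; rewrite inE.
have [c cL] : exists c, c \in L e0.
  have := Lsize e0 e0H; case: (L e0) => // c l _.
  by exists c; rewrite mem_head.
pose K := [set e in H | c \in L e].
have KH : K \subset H by apply/subsetP => e; rewrite inE => /andP[].
have [S [SK Sind Sdom]] := kern K KH.
have SH := subset_trans SK KH.
have S0 : exists f, f \in S.
  have [e0S|e0S] := boolP (e0 \in S); first by exists e0.
  by have [|f fS _] := Sdom e0; [rewrite !inE e0S e0H cL | exists f].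
have [||||gamma [gL gP]] := IHn (H :\: S) (fun e => [seq d <- L e | d \notin [:: c]]).
- have := cardsD H S; rewrite (setIidPr SH) => cD.
  case: S0 => f fS; have := subset_leq_card SH.
  have : 0 < #|S| by apply/card_gt0P; exists f.
  lia.
- move=> K' sK'; apply: kern; apply: subset_trans sK' _; exact: subsetDl.
- by move=> e; rewrite inE => /andP[_ eH]; rewrite filter_uniq ?Luniq.
- move=> e; rewrite inE => /andP[eS eH]; have lt_e := Lsize e eH.
  have sub : [set f in H :\: S | dom e f] \subset [set f in H | dom e f].
    by apply/subsetP => f; rewrite !inE => /andP[/andP[_ ->] ->].
  have [cLe|cLe] := boolP (c \in L e).
    have [|f fS ef] := Sdom e; first by rewrite !inE eS eH cLe.
    have pr : [set f in H :\: S | dom e f] \proper [set f in H | dom e f].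
      rewrite properE sub /=; apply/subsetPn; exists f.
        by rewrite inE ef (subsetP SH).
      by rewrite !inE fS.
    have := size_filter_notin [:: c] (Luniq e eH); have := proper_card pr.
    by clear -lt_e => /=; lia.
  apply: leq_ltn_trans (subset_leq_card sub) _.
  suff /all_filterP-> : all (fun d => d \notin [:: c]) (L e) by [].
  by apply/allP => d dL; rewrite inE; apply: contraNneq cLe => <-.
exists (fun e => if e \in S then c else gamma e); split.
  move=> e eH; case: ifP => eS.
    by have := subsetP SK e eS; rewrite inE => /andP[].
  by have := gL e; rewrite inE eS eH mem_filter => /(_ isT)/andP[].
have gc e : e \in H -> e \notin S -> gamma e != c.
  move=> eH eS; have := gL e; rewrite inE eS eH mem_filter => /(_ isT)/andP[].
  by rewrite inE.
move=> e f eH fH ef.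
case: ifPn => eS; case: ifPn => fS.
- by have := Sind e f eS fS; rewrite ef.
- by rewrite eq_sym gc.
- exact: gc.
- by apply: gP => //; rewrite inE ?eS ?fS.
Qed.

(** * List colouring of bipartite graphs *)

Lemma card_preim_le (E B : finType) (t : E -> B) (H : {set E}) (Y : {set B})
    (m : nat) :
  {in Y, forall b, #|[set e in H | t e == b]| <= m} ->
  #|[set e in H | t e \in Y]| <= m * #|Y|.
Proof.
move=> le_m; rewrite -sum1dep_card (partition_big t (mem Y)) => [|e /andP[]//].
rewrite mulnC -sum_nat_const; apply: leq_sum => b bY.
apply: leq_trans (le_m b bY); rewrite -sum1dep_card.
apply: eq_leq; apply: eq_bigl => e; case: eqP => [->|]; rewrite ?andbF //.
by rewrite (bY : b \in Y) !andbT.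
Qed.

Lemma card_preim_ge (E B : finType) (t : E -> B) (H : {set E}) (Y : {set B})
    (m : nat) :
  {in Y, forall b, m <= #|[set e in H | t e == b]|} ->
  m * #|Y| <= #|[set e in H | t e \in Y]|.
Proof.
move=> ge_m; rewrite -sum1dep_card (partition_big t (mem Y)) => [|e /andP[]//].
rewrite mulnC -sum_nat_const; apply: leq_sum => b bY.
apply: leq_trans (ge_m b bY) _; rewrite -sum1dep_card.
apply: eq_leq; apply: eq_bigl => e.
by case: eqP => [->|]; rewrite ?andbF // (bY : b \in Y) !andbT.
Qed.

(* Peels off, from the top level [D - 1] down, one edge at each [t]-vertex of *)
(* maximum degree [D], using Hall's theorem to hit every [s]-vertex of degree *)
(* [D] as well. *)
Lemma edge_levels (E A B : finType) (s : E -> A) (t : E -> B) (H : {set E}) :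
  {in H, forall e,
     #|[set f in H | s f == s e]| <= #|[set f in H | t f == t e]|} ->
  exists c : E -> nat,
    [/\ {in H &, forall e f, t e = t f -> c e = c f -> e = f},
        {in H, forall e, c e < #|[set f in H | t f == t e]|} &
        forall a i, #|[set f in H | (s f == a) && (c f <= i)]| <= i.+1].
Proof.
have [n] := ubnP #|H|; elim: n H => // n IHn H; rewrite ltnS => le_n deg_le.
have [->|[e0 e0H]] := set_0Vmem H.
  exists (fun=> 0); split=> [e|e|a i]; rewrite ?inE //.
  by rewrite (_ : [set f in _ | _] = set0) ?cards0 //; apply/setP => f; rewrite !inE.
pose ds (K : {set E}) a := #|[set f in K | s f == a]|.
pose dt (K : {set E}) b := #|[set f in K | t f == b]|.
case: (arg_maxnP (fun e => dt H (t e)) e0H) => e1 e1H e1max.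
have {}e1H : e1 \in H := e1H.
pose D := dt H (t e1).
have D0 : 0 < D by apply/card_gt0P; exists e1; rewrite inE e1H eqxx.
have dsdt e : e \in H -> ds H (s e) <= dt H (t e) := deg_le e.
have dtD e : e \in H -> dt H (t e) <= D := e1max e.
have dsD a : ds H a <= D.
  have [->//|] := posnP (ds H a).
  case/card_gt0P => e; rewrite inE => /andP[eH /eqP<-].
  exact: leq_trans (dsdt e eH) (dtD e eH).
pose X := [set a | ds H a == D].
pose r a := [set t f | f in [set f in H | s f == a]].
(* Hall's condition by double counting: [D] edges leave each vertex of [Y], and at most [D] enter
   each neighbour. *)
have [Y YX|g [ginj gr]] := @hall _ _ (t e1) X r.
  rewrite -(leq_pmul2l D0).
  apply: (@leq_trans #|[set f in H | s f \in Y]|).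
    by apply: card_preim_ge => a /(subsetP YX); rewrite inE -/(ds H a) => /eqP->.
  apply: (@leq_trans #|[set f in H | t f \in \bigcup_(y in Y) r y]|).
    apply/subset_leq_card/subsetP => f; rewrite !inE => /andP[fH sY].
    rewrite fH; apply/bigcupP; exists (s f) => //; apply/imsetP.
    by exists f; rewrite ?inE ?fH ?eqxx.
  apply: card_preim_le => b /bigcupP[a _ /imsetP[f]].
  by rewrite inE => /andP[fH _] ->; apply: dtD.
(* The edge peeled at [b]: the matching edge if [b] is matched, an arbitrary edge at [b]
   otherwise. *)
have mex b : exists e, dt H b = D ->
    [/\ e \in H, t e = b & {in X, forall a, g a = b -> s e = a}].
  have [/exists_inP[a aX /eqP gab]|] := boolP [exists a in X, g a == b].
    have /imsetP[f] := gr a aX; rewrite inE => /andP[fH /eqP sf] tf.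
    exists f => _; split; rewrite -?tf //= => a' a'X gab'.
    by rewrite sf; apply: ginj; rewrite // gab.
  rewrite negb_exists_in => /forall_inP nog.
  have [dtb|ne] := eqVneq (dt H b) D; last by exists e0 => eqb; rewrite eqb eqxx in ne.
  have : 0 < dt H b by rewrite dtb.
  case/card_gt0P => e; rewrite inE => /andP[eH /eqP te]; exists e => _; split=> //.
  by move=> a aX gab; have := nog a aX; rewrite gab eqxx.
have {mex}[m mP] := choice mex.
pose M := [set m b | b in [set b | dt H b == D]].
have MP e : e \in M -> [/\ e \in H, dt H (t e) = D & e = m (t e)].
  case/imsetP => b; rewrite inE => /eqP dtb ->.
  by case: (mP b dtb) => mH tm _; rewrite tm.
have MH : M \subset H by apply/subsetP => e /MP[].
have mM b : dt H b = D -> m b \in M.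
  by move=> dtb; apply/imsetP; exists b; rewrite ?inE ?dtb ?eqxx.
pose H' := H :\: M.
have H'H : H' \subset H := subsetDl H M.
have dt'_le b : dt H' b <= dt H b.
  by apply/subset_leq_card/subsetP => f; rewrite !inE => /andP[/andP[_ ->]].
have ds'_le a : ds H' a <= ds H a.
  by apply/subset_leq_card/subsetP => f; rewrite !inE => /andP[/andP[_ ->]].
have dt'_top b : dt H b = D -> dt H' b = D.-1.
  move=> dtb; have [mH tm _] := mP b dtb.
  rewrite -dtb /dt (cardsD1 (m b) [set f in H | _]) inE mH tm eqxx /=.
  congr #|pred_of_set _|; apply/setP => f; rewrite !inE.
  have [tf|_] := eqVneq (t f) b; rewrite ?andbF ?andbT //.
  congr (~~ _ && _); apply/idP/eqP => [/MP[_ _ ->]|->]; last exact: mM.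
  by rewrite tf.
have dt'_low b : dt H b != D -> dt H' b = dt H b.
  move=> dtb; congr #|pred_of_set _|; apply/setP => f; rewrite !inE.
  case fM: (f \in M) => //=.
  have [_ dtf _] := MP f fM; case: eqP => [tf|]; rewrite ?andbF //.
  by rewrite -tf dtf eqxx in dtb.
have ds'_top a : a \in X -> ds H' a < D.
  move=> aX; have := aX; rewrite inE => /eqP dsa.
  have /imsetP[f] := gr a aX; rewrite inE => /andP[fH /eqP sf] gaf.
  (* By [deg_le], neighbours of an [s]-vertex of degree [D] have degree [D] too, so its matching
     edge is among the peeled ones. *)
  have dtf : dt H (t f) = D.
    by apply/eqP; rewrite eqn_leq dtD //= -dsa -sf dsdt.
  have [mH tm /(_ a aX gaf) sm] := mP _ dtf.
  rewrite -dsa; apply/proper_card; rewrite properE; apply/andP; split.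
    by apply/subsetP => h; rewrite !inE => /andP[/andP[_ ->]].
  apply/subsetPn; exists (m (t f)); first by rewrite inE mH sm eqxx.
  by rewrite !inE mM.
have [||c' [cinj clt cle]] := IHn H'.
- apply: leq_trans le_n; apply: proper_card; rewrite properE H'H /=.
  by apply/subsetPn; exists (m (t e1)); [case: (mP _ (erefl D))|rewrite inE mM].
(* A [t]-degree changes only from [D] to [D - 1], and by then all [s]-degrees are below [D]. *)
- move=> e eH'; have eH := subsetP H'H e eH'.
  have [dte|dte] := eqVneq (dt H (t e)) D; last first.
    by rewrite -/(dt H' (t e)) dt'_low // (leq_trans (ds'_le _)) // dsdt.
  rewrite -/(dt H' (t e)) dt'_top // -ltnS prednK //.
  have [/ds'_top//|] := boolP (s e \in X).
  rewrite inE => neD; apply: leq_ltn_trans (ds'_le _) _.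
  by rewrite ltn_neqAle neD dsD.
exists (fun e => if e \in M then D.-1 else c' e).
have c'lt e : e \in H -> e \notin M -> dt H (t e) = D -> c' e < D.-1.
  by move=> eH eM dte; rewrite -(dt'_top _ dte); apply: clt; rewrite inE eM.
split.
- move=> e f eH fH eqt; case: ifPn => eM; case: ifPn => fM.
  + by case: (MP e eM) (MP f fM) => [_ _ ->] [_ _ ->]; rewrite eqt.
  + have [_ dte _] := MP e eM => eqc; rewrite eqt in dte.
    by have := c'lt f fH fM dte; rewrite -eqc ltnn.
  + have [_ dtf _] := MP f fM => eqc; rewrite -eqt in dtf.
    by have := c'lt e eH eM dtf; rewrite eqc ltnn.
  + by apply: cinj; rewrite ?inE ?eM ?fM.
- move=> e eH; case: ifPn => eM.
    by have [_ dte _] := MP e eM; rewrite -/(dt H (t e)) dte prednK.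
  by apply: leq_trans (dt'_le (t e)); apply: clt; rewrite inE eM.
- move=> a i; have [le_Di|lt_iD] := leqP D i.+1.
    apply: leq_trans le_Di; apply: leq_trans (dsD a).
    by apply/subset_leq_card/subsetP => f; rewrite !inE => /and3P[-> ->].
  apply: leq_trans (cle a i); apply/subset_leq_card/subsetP => f; rewrite !inE.
  case: ifPn => [fM /and3P[_ _]|fM]; last by case/and3P=> -> -> ->.
  by rewrite leqNgt -ltnS prednK ?lt_iD.
Qed.

(* Galvin's argument: [t]-vertices prefer high levels, [s]-vertices low ones; *)
(* an edge [e] at level [c e] then has at most [c e] competitors at its       *)
(* [s]-end and at most [d (t e) - 1 - c e] at its [t]-end. *)
Lemma bipartite_list_colouring (E A B : finType) (s : E -> A) (t : E -> B)
    (H : {set E}) (L : E -> seq nat) :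
  {in H, forall e,
     #|[set f in H | s f == s e]| <= #|[set f in H | t f == t e]|} ->
  {in H, forall e, uniq (L e)} ->
  {in H, forall e, #|[set f in H | t f == t e]| <= size (L e)} ->
  exists gamma : E -> nat, {in H, forall e, gamma e \in L e} /\
    {in H &, forall e f, e != f -> (s e == s f) || (t e == t f) ->
                         gamma e != gamma f}.
Proof.
move=> deg_le Luniq Lsize; have [c [cinj clt cle]] := edge_levels deg_le.
(* Smaller keys are preferred. Levels may coincide at an [s]-vertex, so [ks] breaks ties by
   [enum_rank]; [kt] reverses the levels, and its subtraction never truncates by [cE]. *)
pose ks e := c e * #|E| + enum_rank e.
pose kt e := #|E| - c e.
have cE e : e \in H -> c e < #|E|.
  by move=> /clt/leq_trans; apply; apply: max_card.
have ksinj : injective ks.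
  move=> e f; rewrite /ks => eqk; apply/enum_rank_inj/val_inj => /=.
  have := congr1 (modn^~ #|E|) eqk.
  by rewrite !modnMDl !modn_small.
have kslt e f : ks f < ks e -> c f <= c e.
  apply: contraTleq => lt_c; rewrite -leqNgt /ks.
  apply: (@leq_trans ((c e).+1 * #|E|)).
    by rewrite mulSn addnC leq_add2r ltnW.
  by apply: leq_trans (leq_addr _ _); rewrite leq_mul2r lt_c orbT.
have ktlt e f : e \in H -> f \in H -> (kt f < kt e) = (c e < c f).
  by move=> /cE + /cE; rewrite /kt; clear; lia.
pose dom e f := (s e == s f) && (ks f < ks e) || (t e == t f) && (kt f < kt e).
have [K KH||gamma [gL gP]] := @kernel_colouring _ dom H L _ Luniq.
- have [||S [SK Smat Sdom]] := @stable_matching _ _ _ s t ks kt K.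
  + by move=> e f _ _ _ /ksinj.
  + move=> e f /(subsetP KH) eH /(subsetP KH) fH eqt eqk.
    apply: cinj => //; move: eqk (cE e eH) (cE f fH); rewrite /kt; clear; lia.
  exists S; split=> // e f eS fS; have [->|neq] := eqVneq e f.
    by rewrite /dom !ltnn !andbF.
  by have [/negPf ns /negPf nt] := Smat e f eS fS neq; rewrite /dom ns nt.
- move=> e eH; apply: leq_trans (Lsize e eH).
  pose P := [set f in H | (s f == s e) && (c f <= c e)].
  pose Q := [set f in H | (t f == t e) && (c e < c f)].
  (* [P] contains [e] itself, which turns the bound [c e + 1] into [c e]. *)
  have leP : #|P :\ e| <= c e.
    by have := cle (s e) (c e); rewrite -/P (cardsD1 e) !inE eH eqxx leqnn.
  have leQ : #|Q| <= #|[set f in H | t f == t e]| - (c e).+1.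
    rewrite cardE -(size_map c) -(size_iota (c e).+1 (_ - _)) uniq_leq_size //.
      rewrite map_inj_in_uniq ?enum_uniq // => f g.
      rewrite !mem_enum !inE => /and3P[fH /eqP tf _] /and3P[gH /eqP tg _].
      by apply: cinj; rewrite // tf.
    move=> _ /mapP[f + ->]; rewrite mem_enum !inE => /and3P[fH /eqP tf ltc].
    by rewrite mem_iota ltc subnKC ?clt // -tf clt.
  have sub : [set f in H | dom e f] \subset (P :\ e) :|: Q.
    apply/subsetP => f; rewrite !inE => /andP[fH /orP[|]] /andP[/eqP eqst lt].
      by rewrite fH eqst eqxx (kslt e f lt) /= (contraTneq _ lt) // => ->; rewrite ltnn.
    by rewrite ktlt // in lt; rewrite fH eqst eqxx lt orbT.
  have := subset_leq_card sub; have := (leq_card_setU (P :\ e) Q).1.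
  by have := clt e eH; clear -leP leQ; lia.
exists gamma; split=> // e f eH fH neq /orP adj.
suff [ef|fe] : dom e f \/ dom f e; first exact: gP.
  by rewrite eq_sym gP.
rewrite /dom; case: adj => /eqP eqst.
  have : ks e != ks f by apply: contra_neq neq => /ksinj.
  by rewrite eqst eqxx /= neq_ltn => /orP[->|->]; [right|left].
have : c e != c f by apply: contra_neq neq; apply: cinj.
by rewrite eqst eqxx !ktlt //= neq_ltn => /orP[->|->]; rewrite orbT; [left|right].
Qed.

(** * Trimming a bipartite graph *)

(* While some vertex of [W] has fewer than [#|W|] neighbours in [U], delete   *)
(* it together with these neighbours. *)
Lemma dense_subset (V : finType) (r : rel V) (U W : {set V}) :
  #|W| * #|W|.-1 < 2 * #|U| ->
  exists U' : {set V}, [/\ U' \subset U, U' != set0 &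
    forall u w, u \in U' -> w \in W -> r u w ->
      #|[set x in W | r u x]| <= #|[set x in U' | r x w]|].
Proof.
have [n] := ubnP #|W|; elim: n U W => // n IHn U W; rewrite ltnS => le_n ltU.
have U0 : U != set0 by apply: contraTneq ltU => ->; rewrite cards0.
(* Vertices of [W] without neighbours in [U] satisfy the conclusion vacuously, hence the condition
   [0 <]. *)
have [/exists_inP[w wW ltw]|] :=
  boolP [exists w in W, 0 < #|[set x in U | r x w]| < #|W|]; last first.
  rewrite negb_exists_in => /forall_inP nolow.
  exists U; split=> // u w uU wW uw.
  apply: (@leq_trans #|W|).
    by apply/subset_leq_card/subsetP => x; rewrite inE => /andP[].
  rewrite leqNgt; apply: contra (nolow w wW) => ->; rewrite andbT.
  by apply/card_gt0P; exists u; rewrite inE uU.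
pose N := [set x in U | r x w].
have NU : N \subset U by apply/subsetP => x; rewrite inE => /andP[].
have cW : #|W| = #|W :\ w|.+1 by rewrite (cardsD1 w W) wW.
have [||U' [sU' U'0 U'P]] := IHn (U :\: N) (W :\ w).
- by rewrite -ltnS -cW.
(* At most [#|W| - 1] vertices of [U] are lost, while [#|W| * (#|W| - 1)] drops by
   [2 * (#|W| - 1)]. *)
- have := cardsD U N; rewrite (setIidPr NU) => ->.
  case/andP: ltw => _; move: ltU; rewrite -/N cW; clear.
  case: #|W :\ w| => [|m] /=; nia.
(* The surviving vertices of [U] do not see [w], so deleting it leaves their degrees into [W]
   unchanged. *)
have nw u : u \in U' -> r u w = false.
  move=> /(subsetP sU'); rewrite !inE => /andP[+ uU].
  by rewrite uU => /negPf.
exists U'; split=> //; first exact: subset_trans sU' (subsetDl _ _).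
move=> u v uU' vW uv; apply: leq_trans (U'P u v uU' _ uv).
  apply: subset_leq_card; apply/subsetP => x; rewrite !inE => /andP[-> ux].
  by rewrite ux !andbT; apply: contraTneq ux => ->; rewrite nw.
by rewrite !inE vW andbT; apply: contraTneq uv => ->; rewrite nw.
Qed.

(** * Rooted trees and tree decompositions *)

Section RootedTree.
Variable T : sgraph.
Implicit Types x y z : T.

(** A shortened path from [x] to [y] avoiding the edge [xy] has an inner vertex, so this edge would
    close it to a cycle. *)
Lemma acyclic_bridge x y : acyclic T -> x -- y ->
  ~ connect (fun u v : T => (u -- v) && ([set u; v] != [set x; y])) x y.
Proof.
set e := fun u v : T => _; move=> acyc xy /connectP[p pth lst].
case/shortenP: pth lst => p' pth upth _ lst.
have pthG : path (@adj T) x p' by apply: sub_path pth => u v /andP[].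
apply: (acyc (x :: p')).
  case: p' pth {upth pthG} lst => [|z [|z' p'']] //=.
    by move=> _ eqxy; rewrite eqxy adj_irr in xy.
  by move=> /andP[/andP[_]] + _ eqy; rewrite -eqy eqxx.
rewrite /ucycle upth andbT /= rcons_path pthG /= -lst.
by rewrite adj_sym.
Qed.

(** Take for [d] the length of a shortest walk from the root; the last but one vertex of such a walk
    is nearer. *)
Lemma ex_depth (root : T) : connected_in [set: T] -> exists d : T -> nat,
  forall x, x != root -> exists2 y, x -- y & d y < d x.
Proof.
move=> conn.
have walk x : exists n, `[< exists p,
    [/\ path (@adj T) root p, last root p = x & size p = n] >].
  have /connectP[p pth lst] := conn root x (in_setT _) (in_setT _).
  exists (size p); apply/asboolP; exists p; split=> //.
  by apply: sub_path pth => u v /and3P[].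
exists (fun x => ex_minn (walk x)) => x nx.
case: (ex_minnP (walk x)) => n /asboolP[p [pth lst sz]] _.
case/lastP: p pth lst sz => [|p z] /=; first by move=> _ eqx; rewrite eqx eqxx in nx.
rewrite rcons_path last_rcons size_rcons => /andP[pth lz] eqz szp.
exists (last root p); first by rewrite adj_sym -eqz.
case: ex_minnP => m _ /(_ (size p)); rewrite -szp ltnS; apply.
by apply/asboolP; exists p.
Qed.

(* An edge between vertices of equal depth, or two edges from a vertex to     *)
(* lower depths, would close a cycle through the root. *)
Lemma tree_depth : is_tree T -> exists d : T -> nat,
  (forall x y, x -- y -> d x != d y) /\
  (forall x y z, x -- y -> x -- z -> d y < d x -> d z < d x -> y = z).
Proof.
case=> /card_gt0P[root _] conn acyc.
have [d dP] := ex_depth root conn.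
pose low x u v := [&& u != x, v != x & u -- v].
have low_sym x : connect_sym (low x).
  by apply: sym_connect_sym => u v; rewrite /low adj_sym andbCA.
(* Descending from [y] never meets [x], since all later vertices have depth below [d x]. *)
have toroot x y : y != x -> d y <= d x -> connect (low x) y root.
  have [n] := ubnP (d y); elim: n y => // n IHn y; rewrite ltnS => le_n yx le_d.
  have [->|/dP[z yz lt_d]] := eqVneq y root; first exact: connect0.
  have zx : z != x by apply: contraTneq (leq_trans lt_d le_d) => ->; rewrite ltnn.
  apply: connect_trans (connect1 _) (IHn z _ zx _).
  - by rewrite /low yx zx.
  - exact: leq_trans lt_d le_n.
  - exact: leq_trans (ltnW lt_d) le_d.
pose cut x y u v := (u -- v) && ([set u; v] != [set x; y]).
have cut_sym x y : connect_sym (cut x y).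
  by apply: sym_connect_sym => u v; rewrite /cut adj_sym setUC.
(* A walk that avoids an end of [xy] avoids this edge. *)
have lowl x y u v : connect (low x) u v -> connect (cut x y) u v.
  apply: connect_sub => {}u {}v /and3P[ux vx uv]; apply: connect1.
  rewrite /cut uv; apply: contraNneq ux => /setP/(_ x).
  by rewrite !inE eqxx eq_sym [x == v]eq_sym (negPf vx) orbF.
have lowr x y u v : connect (low y) u v -> connect (cut x y) u v.
  apply: connect_sub => {}u {}v /and3P[ux vx uv]; apply: connect1.
  rewrite /cut uv; apply: contraNneq ux => /setP/(_ y).
  by rewrite !inE eqxx orbT eq_sym [y == v]eq_sym (negPf vx) orbF.
have neq x y : x -- y -> x != y by apply: contraTneq => ->; rewrite adj_irr.
exists d; split=> [x y xy|x y z xy xz lty ltz]; apply/eqP.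
  move=> eqd; apply: (acyclic_bridge acyc xy).
  apply: (@connect_trans _ _ root).
    by apply/lowr/toroot; rewrite ?neq // eqd.
  by rewrite cut_sym; apply/lowl/toroot; rewrite ?eqd // eq_sym neq.
apply/negPn/negP => yz; apply: (acyclic_bridge acyc xy).
apply: (@connect_trans _ _ z).
  apply: connect1; rewrite xz /=; apply: contraNneq yz => /setP/(_ z).
  rewrite !inE eqxx orbT eq_sym (negPf (neq x z xz)) /=.
  by move/esym/eqP->.
apply: (@connect_trans _ _ root).
  by apply/lowl/toroot; rewrite ?(ltnW ltz) // eq_sym neq.
by rewrite cut_sym; apply/lowl/toroot; rewrite ?(ltnW lty) // eq_sym neq.
Qed.

End RootedTree.

(* Among the tops of the subtrees of the vertices of [S], take a deepest one. *)
Lemma tree_decomposition_top (G T : sgraph) (bag : T -> {set G}) (S : {set G}) :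
  tree_decomposition bag -> S != set0 ->
  exists v t, [/\ v \in S, v \in bag t &
    forall u, u -- v -> u \notin bag t ->
      u \notin S /\ forall x, x \in S -> u -- x -> x \in bag t].
Proof.
case=> /tree_depth[d [neq_d uniq_up]] cover edgecover conn /set0Pn[v0 v0S].
pose up a b := (a -- b) && (d b < d a).
have up_le a b : connect up a b -> (a == b) || (d b < d a).
  case/connectP=> p; elim: p a => [|c p IHp] a /=; first by move=> _ ->; rewrite eqxx.
  case/andP=> /andP[_ lt] pth eqb; have := IHp c pth eqb.
  by case/orP=> [/eqP<-|/ltn_trans/(_ lt)->]; rewrite ?lt orbT.
(* If [t] is the top of the subtree of [v] or lies outside it, a walk within this subtree that
   starts below [t] stays below: it could leave only by stepping up from [t]. *)
have below v t a b : (v \in bag t -> forall c, v \in bag c -> d t <= d c) ->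
    v \in bag a -> v \in bag b -> connect up a t -> connect up b t.
  move=> top va vb.
  have := conn v a b; rewrite !inE => /(_ va vb)/connectP[p].
  elim: p a {va} => [|c p IHp] a /=; first by move=> _ ->.
  case/andP=> /and3P[]; rewrite !inE => va vc ac pth eqb at_; apply: (IHp c pth eqb).
  have := neq_d _ _ ac; rewrite neq_ltn => /orP[lt|lt].
    by apply: connect_trans at_; apply: connect1; rewrite /up adj_sym ac.
  case/connectP: at_ => [[|e q]] /= => [_ eqt|/andP[/andP[ae lte] pq] eqt].
    by rewrite eqt in top; have := top va c vc; rewrite leqNgt lt.
  rewrite (uniq_up a c e) //; apply/connectP; by exists q.
have ex_top v : exists t, v \in bag t /\ forall c, v \in bag c -> d t <= d c.
  have [t vt] := cover v; case: (arg_minnP (P := [pred t | v \in bag t]) d vt).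
  by move=> t' /= ? ?; exists t'.
have [top topP] := choice ex_top.
case: (arg_maxnP (d \o top) v0S) => v vS vmax; exists v, (top v).
have [vt vtop] := topP v; split=> // u uv ut.
have [s0 /andP[us0 vs0]] := edgecover u v uv.
have s0t : connect up s0 (top v) by apply: (below v _ (top v)).
(* The bag [s] lies below [top v], as the subtree of [u] misses [top v]. If the subtree of [x]
   missed it too, [top x] would be strictly deeper, against the choice of [v]. *)
have key x : x \in S -> (exists s, (u \in bag s) && (x \in bag s)) -> x \in bag (top v).
  move=> xS [s /andP[us xs]].
  have st : connect up s (top v).
    by apply: (below u _ s0) => //; rewrite (negPf ut).
  apply/negPn/negP => xt; have [xtop _] := topP x.
  have : connect up (top x) (top v) by apply: (below x _ s) => //; rewrite (negPf xt).
  move/up_le => /orP[/eqP eqt|]; first by rewrite -eqt xtop in xt.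
  by rewrite ltnNge; have /= -> := vmax x xS.
split=> [|x xS ux]; last by apply: key => //; apply: edgecover.
by apply: contra ut => uS; apply: key => //; exists s0; rewrite us0.
Qed.

(** * Extending partial list edge-colourings *)

Section Colourings.
Variable V : finType.
Implicit Types (F : {set {set V}}) (L : {set V} -> seq nat).

(** Subgraphs are represented by edge sets [F] on a fixed vertex set, so one tree decomposition
    serves the whole induction. Lists are sequences, from which used colours can be filtered. *)
Definition edge_degree F v := #|[set e in F | v \in e]|.

Definition colours F L (gamma : {set V} -> nat) :=
  {in F, forall e, gamma e \in L e} /\
  {in F &, forall e f, e != f -> e :&: f != set0 -> gamma e != gamma f}.

(** The edge meets at most [d(u) + d(v) - 2] others, fewer than its list has colours. *)
Lemma extend_edge F L gamma u v :
  [set u; v] \in F -> uniq (L [set u; v]) ->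
  edge_degree F u + edge_degree F v <= (size (L [set u; v])).+1 ->
  colours (F :\ [set u; v]) L gamma -> exists gamma', colours F L gamma'.
Proof.
set e := [set u; v] => eF Luniq le_deg [gL gP].
pose N := [set f in F :\ e | f :&: e != set0].
have degE x : x \in e -> edge_degree F x = #|[set f in F | x \in f] :\ e|.+1.
  by move=> xe; rewrite /edge_degree (cardsD1 e) inE eF xe.
have sub : N \subset ([set f in F | u \in f] :\ e) :|: ([set f in F | v \in f] :\ e).
  apply/subsetP => f; rewrite !inE => /andP[/andP[-> ->] /set0Pn[x]].
  by rewrite !inE => /andP[xf /orP[] /eqP<-]; rewrite xf ?orbT.
have leN : #|N| < size (L e).
  have := subset_leq_card sub.
  have := (leq_card_setU ([set f in F | u \in f] :\ e) ([set f in F | v \in f] :\ e)).1.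
  move: le_deg; rewrite (degE u) ?(degE v) ?inE ?eqxx ?orbT //; clear; lia.
have : 0 < size [seq c <- L e | c \notin map gamma (enum N)].
  have := size_filter_notin (map gamma (enum N)) Luniq.
  rewrite size_map -cardE => le_L; rewrite -(ltn_add2r #|N|) add0n.
  exact: leq_trans leN le_L.
case def_l: [seq c <- L e | _] => [|c l] // _.
have : c \in [seq c <- L e | c \notin map gamma (enum N)] by rewrite def_l mem_head.
rewrite mem_filter => /andP[cN cL].
have cP f : f \in F -> f != e -> f :&: e != set0 -> gamma f != c.
  move=> fF fe meet; apply: contraNneq cN => <-; apply: map_f.
  by rewrite mem_enum !inE fe fF.
exists (fun f => if f == e then c else gamma f); split.
  move=> f fF; case: eqVneq => [->//|fe]; apply: gL; by rewrite !inE fe.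
move=> f g fF gF.
case: (eqVneq f e) => [->|fe]; case: (eqVneq g e) => [->|ge].
- by rewrite eqxx.
- by rewrite setIC => _ meet; rewrite eq_sym cP.
- by move=> _ ?; rewrite cP.
- by apply: gP; rewrite !inE ?fe ?ge.
Qed.

(** All edges at [u] in [U] are still uncoloured, so an edge [uw] loses colours only to coloured
    edges at [w]. Of [D] colours it keeps at least as many as there are uncoloured edges at [w]. *)
Lemma extend_bipartite F L gamma (D : nat) (U W : {set V}) :
  [disjoint U & W] ->
  {in F, forall e, uniq (L e)} -> {in F, forall e, D <= size (L e)} ->
  (forall v, edge_degree F v <= D) ->
  (forall e u, e \in F -> u \in U -> u \in e ->
     exists2 w, w \in W & e = [set u; w]) ->
  (forall u w, u \in U -> w \in W -> [set u; w] \in F ->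
     #|[set x in W | [set u; x] \in F]| <= #|[set x in U | [set x; w] \in F]|) ->
  colours (F :\: [set e in F | e :&: U != set0]) L gamma ->
  exists gamma', colours F L gamma'.
Proof.
set H := [set e in F | _] => disjUW Luniq Lsize leD bip dense [gL gP].
(* The [U]-end and the [W]-end of an edge; on [H] neither value is [None]. *)
pose s e := [pick x in e :&: U]; pose t e := [pick x in e :\: U].
have notU w : w \in W -> w \notin U.
  by move=> wW; apply: contraL wW => wU; rewrite (disjointFr disjUW).
have sE u w : u \in U -> w \in W -> s [set u; w] = Some u.
  move=> uU /notU/negPf wU; rewrite /s; case: pickP => [x|/(_ u)]; last first.
    by rewrite !inE eqxx uU.
  by rewrite !inE => /andP[/orP[]/eqP-> //]; rewrite wU.
have tE u w : u \in U -> w \in W -> t [set u; w] = Some w.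
  move=> uU /notU/negPf wU; rewrite /t; case: pickP => [x|/(_ w)]; last first.
    by rewrite !inE eqxx wU orbT.
  by rewrite !inE => /andP[xU /orP[]/eqP eqx //]; rewrite eqx ?uU // in xU *.
have HP e : e \in H -> exists u w, [/\ u \in U, w \in W & e = [set u; w]].
  rewrite inE => /andP[eF /set0Pn[u]]; rewrite inE => /andP[ue uU].
  by have [w wW eE] := bip e u eF uU ue; exists u, w.
have inH u w : u \in U -> [set u; w] \in F -> [set u; w] \in H.
  by move=> uU eF; rewrite inE eF; apply/set0Pn; exists u; rewrite !inE eqxx.
pose N e := [set f in F :\: H | f :&: e != set0].
pose L' e := [seq c <- L e | c \notin map gamma (enum (N e))].
have HF : H \subset F by apply/subsetP => e; rewrite inE => /andP[].
have [e eH|e eH|e eH|g1 [g1L g1P]] := @bipartite_list_colouring _ _ _ s t H L'.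
- have [u [w [uU wW eE]]] := HP e eH; have eF := subsetP HF e eH.
  rewrite eE in eF *; rewrite sE // tE //.
  apply: (@leq_trans #|[set x in W | [set u; x] \in F]|).
    apply: leq_trans (leq_imset_card (fun x => [set u; x]) _).
    apply/subset_leq_card/subsetP => f; rewrite inE => /andP[fH].
    have [u' [w' [u'U w'W fE]]] := HP f fH; rewrite fE sE // => /eqP[eqU].
    rewrite -eqU; apply/imsetP; exists w' => //.
    by rewrite inE w'W -fE (subsetP HF).
  apply: leq_trans (dense u w uU wW eF) _.
  have inj : {in [set x in U | [set x; w] \in F] &,
               injective (fun x => [set x; w])}.
    move=> x y; rewrite !inE => /andP[xU _] _ /setP/(_ x); rewrite !inE eqxx /=.
    case: eqP => //= _ /esym/eqP eqxw; by rewrite eqxw (negPf (notU w wW)) in xU.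
  rewrite -(card_in_imset inj); apply/subset_leq_card/subsetP => f.
  case/imsetP => x; rewrite inE => /andP[xU xF] ->.
  by rewrite inE inH // tE // eqxx.
- exact: filter_uniq (Luniq e (subsetP HF e eH)).
- have [u [w [uU wW eE]]] := HP e eH; have eF := subsetP HF e eH.
  have := size_filter_notin (map gamma (enum (N e))) (Luniq e eF).
  rewrite size_map -cardE -/(L' e) (_ : t e = Some w); last by rewrite eE tE.
  set P := [set f in H | _].
  (* [P] and [N e] are disjoint sets of edges at [w], so their sizes sum to at most [D]. *)
  have sub : P :|: N e \subset [set f in F | w \in f].
    apply/subsetP => f; rewrite !inE => /orP[].
      case/andP=> /andP[fF fU]; have fH : f \in H by rewrite inE fF.
      have [u' [w' [u'U w'W fE]]] := HP f fH; rewrite fF fE tE // => /eqP[->].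
      by rewrite !inE eqxx orbT.
    case/andP=> /andP[fH fF] /set0Pn[x]; rewrite inE => /andP[xf].
    rewrite fF eE !inE => /orP[]/eqP eqx; rewrite eqx in xf => //.
    by rewrite fF /= in fH; case/set0Pn: fH; exists u; rewrite inE xf.
  have disj : P :&: N e = set0.
    apply/setP => f; rewrite !inE; case: (f \in F) => //=.
    by case: (_ != set0); rewrite ?andbF.
  move=> le_L; rewrite -(leq_add2r #|N e|); apply: leq_trans le_L.
  apply: leq_trans (Lsize e eF); apply: leq_trans (leD w).
  by apply: leq_trans (subset_leq_card sub); rewrite cardsU disj cards0 subn0.
have g1L' e : e \in H -> (g1 e \in L e) /\
    forall f, f \in F -> f \notin H -> f :&: e != set0 -> gamma f != g1 e.
  move=> eH; have := g1L e eH; rewrite mem_filter => /andP[cN cL]; split=> // f fF fH meet.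
  apply: contraNneq cN => <-; apply: map_f.
  by rewrite mem_enum inE in_setD fF fH.
exists (fun e => if e \in H then g1 e else gamma e); split.
  move=> e eF; case: ifPn => eH; first by case: (g1L' e eH).
  by apply: gL; rewrite in_setD eH.
move=> e f eF fF; case: ifPn => eH; case: ifPn => fH.
- move=> neq meet; apply: g1P => //.
  have [u [w [uU wW eE]]] := HP e eH; have [u' [w' [u'U w'W fE]]] := HP f fH.
  move: meet; rewrite eE fE !sE // !tE // => /set0Pn[x]; rewrite !inE.
  case/andP=> /orP[]/eqP-> /orP[]/eqP eqx; rewrite ?eqx ?eqxx ?orbT //.
    by have := notU w' w'W; rewrite -eqx uU.
  by have := notU w wW; rewrite eqx u'U.
- by rewrite setIC => _ meet; case: (g1L' e eH) => _; rewrite eq_sym; apply.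
- by move=> _; case: (g1L' f fH) => _; apply.
- by apply: gP; rewrite in_setD ?eH ?fH.
Qed.

End Colourings.

(** * The induction on edges and the theorem *)

Lemma mem_edges (G : sgraph) (a b : G) : ([set a; b] \in edges G) = a -- b.
Proof.
apply/imsetP/idP => [[[c d]] /=|ab]; last by exists (a, b).
rewrite inE /= => cd eqs.
have ncd : c != d by apply: contraTneq cd => ->; rewrite adj_irr.
have /setP eqm := eqs; have := eqm d; have := eqm c; rewrite !inE !eqxx orbT /=.
case/orP=> /eqP eqc /orP[] /eqP eqd; move: cd ncd; rewrite eqc eqd ?eqxx //.
by rewrite adj_sym.
Qed.

Lemma edgesP (G : sgraph) (e : {set G}) (u : G) :
  e \in edges G -> u \in e -> exists x, e = [set u; x].
Proof.
case/imsetP => [[c d]] _ ->; rewrite !inE => /orP[]/eqP->; first by exists d.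
by exists c; rewrite setUC.
Qed.

(** The tree decomposition enters only through the first hypothesis. It is quantified over [S]
    because the set of vertices of large degree changes with [F]. *)
Lemma subgraph_colouring (G : sgraph) (k D : nat) (L : {set G} -> seq nat) :
  (forall S : {set G}, S != set0 -> exists v (B : {set G}),
     [/\ v \in S, v \in B, #|B| <= k.+1 &
         forall u, u -- v -> u \notin B ->
           u \notin S /\ forall x, x \in S -> u -- x -> x \in B]) ->
  (k + 3) ^ 2 <= 2 * D ->
  forall F : {set {set G}}, F \subset edges G ->
  (forall v, edge_degree F v <= D) ->
  {in F, forall e, uniq (L e)} -> {in F, forall e, D <= size (L e)} ->
  exists gamma, colours F L gamma.
Proof.
move=> star le_kD F; have [n] := ubnP #|F|; elim: n F => // n IHn F.
rewrite ltnS => le_n FG leD Luniq Lsize.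
have IHsub (F' : {set {set G}}) : F' \proper F -> exists gamma, colours F' L gamma.
  move=> pF; have /subsetP F'F := proper_sub pF; apply: IHn.
  - exact: leq_trans (proper_card pF) le_n.
  - exact: subset_trans (proper_sub pF) FG.
  - move=> v; apply: leq_trans (leD v); apply/subset_leq_card/subsetP => e.
    by rewrite !inE => /andP[/F'F-> ->].
  - by move=> e /F'F; apply: Luniq.
  - by move=> e /F'F; apply: Lsize.
have [->|[e0 e0F]] := set_0Vmem F.
  by exists (fun=> 0); split=> e; rewrite inE.
have [/existsP[u /existsP[v /andP[eF le_uv]]]|] := boolP [exists u, [exists v,
    ([set u; v] \in F) && (edge_degree F u + edge_degree F v <= D.+1)]].
  have [|gamma gP] := IHsub (F :\ [set u; v]); first exact: properD1.
  apply: extend_edge gP => //; first exact: Luniq.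
  by apply: leq_trans le_uv _; rewrite ltnS Lsize.
move=> noedge.
have {noedge} gt_uv u v : [set u; v] \in F ->
    D.+1 < edge_degree F u + edge_degree F v.
  move=> eF; rewrite ltnNge; apply: contra noedge => le_uv.
  by apply/existsP; exists u; apply/existsP; exists v; rewrite eF.
have FP e u : e \in F -> u \in e -> exists x, e = [set u; x].
  by move=> /(subsetP FG); apply: edgesP.
have Fadj a b : [set a; b] \in F -> a -- b.
  by move=> /(subsetP FG); rewrite mem_edges.
pose S := [set v | D < 2 * edge_degree F v].
have inS u x : u \notin S -> [set u; x] \in F -> x \in S.
  by rewrite !inE => uS /gt_uv; move: uS; clear; lia.
have S0 : S != set0.
  have /imsetP[[a b] _ /= e0E] := subsetP FG e0 e0F; rewrite e0E in e0F.
  apply/set0Pn; have [aS|/inS/(_ e0F)] := boolP (a \in S); first by exists a.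
  by exists b.
have [v [B [vS vB leB starB]]] := star S S0.
pose N := [set u | ([set u; v] \in F) && (u \notin B)].
have NB u x : u \in N -> [set u; x] \in F -> x \in B.
  rewrite inE => /andP[uvF uB] uxF.
  have [uS inB] := starB u (Fadj u v uvF) uB.
  by apply: inB (Fadj _ _ uxF); apply: inS uxF.
have degN u : u \in N -> edge_degree F u <= k.+1.
  move=> uN; apply: leq_trans leB.
  apply: leq_trans (leq_imset_card (fun x => [set u; x]) B).
  apply/subset_leq_card/subsetP => e; rewrite inE => /andP[eF ue].
  have [x eE] := FP e u eF ue; rewrite eE in eF *.
  by apply/imsetP; exists x => //; apply: NB eF.
have degv : edge_degree F v <= #|N| + k.
  apply: (@leq_trans #|N :|: (B :\ v)|); last first.
    apply: leq_trans (leq_card_setU _ _) _; rewrite leq_add2l.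
    by move: leB; rewrite (cardsD1 v B) vB.
  apply: leq_trans (leq_imset_card (fun x => [set x; v]) _).
  apply/subset_leq_card/subsetP => e; rewrite inE => /andP[eF ve].
  have [x eE] := FP e v eF ve; rewrite setUC in eE; rewrite eE in eF *.
  apply/imsetP; exists x => //; rewrite !inE eF /=.
  case: (boolP (x \in B)) => //= _; rewrite andbT.
  by apply: contraTneq (Fadj _ _ eF) => ->; rewrite adj_irr.
(* Here [4 * d(v) > 2 * D >= (k + 3)^2 > 4 * k], so [d(v) > k]. *)
have N0 : 0 < #|N|.
  by move: vS; rewrite inE; move: degv le_kD; rewrite expnS expn1; clear; nia.
(* For positive [k] this is [d(v) >= D + 1 - k]; for [k = 0] the truncated form is weaker but still
   suffices below. *)
have dvN : D <= edge_degree F v + k.-1.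
  case/card_gt0P: N0 => u uN; have := degN u uN; have := gt_uv u v.
  have := uN; rewrite inE => /andP[-> _] /(_ isT); clear; lia.
(* For positive [k], [2 * #|N| >= 2 * (D + 1 - 2 * k) >= (k + 3)^2 + 2 - 4 * k > k * (k + 1)]. *)
have [|U [UN U0 Udense]] := @dense_subset _ (fun u w => [set u; w] \in F) N B.
  apply: (@leq_ltn_trans (k.+1 * k)); last first.
    by move: degv dvN le_kD; rewrite expnS expn1; clear; nia.
  by apply: leq_mul => //; move: leB; clear; lia.
have UB u : u \in U -> u \notin B.
  by move=> /(subsetP UN); rewrite inE => /andP[].
have [|gamma gP] := IHsub (F :\: [set e in F | e :&: U != set0]).
  rewrite properE subsetDl; apply/subsetPn.
  have /set0Pn[u uU] := U0; have := subsetP UN u uU; rewrite inE => /andP[uvF _].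
  exists [set u; v] => //; rewrite !inE uvF /= andbT negbK.
  by apply/set0Pn; exists u; rewrite !inE eqxx.
apply: (@extend_bipartite _ F L gamma D U B) gP => //.
- rewrite disjoint_subset; by apply/subsetP => u /UB.
- move=> e u eF uU ue; have [x eE] := FP e u eF ue; exists x => //.
  by apply: (NB u); rewrite ?(subsetP UN) // -eE.
Qed.

Lemma edge_degreeE (G : sgraph) (v : G) : edge_degree (edges G) v = degree v.
Proof.
have inj : {in [set u | v -- u] &, injective (fun u => [set v; u])}.
  move=> x y; rewrite !inE => vx _ /setP/(_ x); rewrite !inE eqxx orbT.
  by move/esym/orP=> [/eqP xv|/eqP//]; rewrite xv adj_irr in vx.
rewrite /degree -(card_in_imset inj); apply: eq_card => e; rewrite inE.
apply/andP/imsetP => [[eE ve]|[u]]; last first.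
  by rewrite inE => vu ->; rewrite mem_edges !inE eqxx.
have [u eqe] := edgesP eE ve; exists u => //.
by rewrite inE -mem_edges -eqe.
Qed.

Lemma max_degree_attained (G : sgraph) :
  0 < max_degree G -> exists v : G, max_degree G = degree v.
Proof.
rewrite /max_degree; elim/big_ind: _ => [//|m n IHm IHn|v _ _]; last by exists v.
by case: (leqP m n).
Qed.

(** If all lists are the same [m] colours, the edges at a vertex of maximum degree receive distinct
    ones among them. *)
Lemma edge_choosable_max_degree (G : sgraph) (m : nat) :
  edge_choosable G m -> max_degree G <= m.
Proof.
have [->//|/max_degree_attained[v ->]] := posnP (max_degree G).
case/(_ (fun=> seq_fset tt (iota 0 m))) => [e _|gamma [gL gP]].
  by rewrite size_seq_fset undup_id ?iota_uniq ?size_iota.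
pose Ev := [set e in edges G | v \in e].
rewrite -edge_degreeE /edge_degree -/Ev -(size_iota 0 m) cardE -(size_map gamma).
apply: uniq_leq_size => [|_ /mapP[e + ->]].
  rewrite map_inj_in_uniq ?enum_uniq // => e f.
  rewrite !mem_enum !inE => /andP[eE ve] /andP[fE vf] eqg.
  apply/eqP/negPn/negP => neq; have meet : e :&: f != set0.
    by apply/set0Pn; exists v; rewrite inE ve.
  by have := gP e f eE fE neq meet; rewrite eqg eqxx.
rewrite mem_enum inE => /andP[eE _]; have := gL e eE.
by rewrite seq_fsetE.
Qed.

Theorem theorem1 (k : nat) (G : sgraph) :
  treewidth G = k ->
  (k + 3) ^ 2 <= 2 * max_degree G ->
  list_chromatic_index G = max_degree G.
Proof.
rewrite /treewidth; case: ex_minnP => w /asboolP[T [bag [dec widthk]]] _ eqk.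
rewrite -{}eqk -{}widthk => le_k.
rewrite /list_chromatic_index; case: ex_minnP => m /asboolP mP mmin.
apply/eqP; rewrite eqn_leq; apply/andP; split.
  apply: mmin; apply/asboolP => L Lsize.
  have [S S0||||gamma] := @subgraph_colouring G (width bag) (max_degree G)
    (fun e => L e) _ le_k (edges G) (subxx _).
  - have [v [t [vS vt star]]] := tree_decomposition_top dec S0.
    exists v, (bag t); split=> //.
    (* The largest bag has at most [width bag + 1] vertices, even where the predecessor
       truncates. *)
    apply: (@leq_trans (\max_t #|bag t|)); last by rewrite /width; case: (\max_t _).
    exact: (leq_bigmax (F := fun t => #|bag t|)).
  - by move=> v; rewrite edge_degreeE /max_degree (leq_bigmax (F := @degree G)).
  - by move=> e _; apply: fset_uniq.
  - by move=> e eE; rewrite -(Lsize e eE).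
  by exists gamma.
exact: edge_choosable_max_degree.
Qed.
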